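(* Let $X\subset\mathbb{R}^n$ be a polytope with $n_v\in\{1,2\}$ vertices and vertex set $X_v$, and let the known upper bound for $n_v$ be $n_f=2$. Run the Two-Vertex Algorithm (described in the context) with the oracle $\mathsf{D}(d)=\max_{v\in X}v^\top d$. If $n_v=1$, then the algorithm terminates after exactly $2n$ oracle calls with the singleton $X_v=P$. If $n_v=2$, then the algorithm terminates after at most $3n-1$ oracle calls with $X_v=\{a,b\}$.
   Context: Polytopes are nonempty and compact. The oracle $\mathsf{D}:\mathbb{R}^n\to\mathbb{R}$, $\mathsf{D}(d)=\max_{v\in X}v^\top d$, is the only access to $X$, apart from knowing that $X$ has at most 2 vertices; an oracle call is one evaluation of $\mathsf{D}$. $\mathrm{e}_i$ is the $i$-th coordinate vector. Two-Vertex Algorithm. Initialization: call the oracle at the $2n$ directions $\pm\mathrm{e}_i$, $i=1,\dots,n$, and set $P=\{v\in\mathbb{R}^n: v^\top d\le\mathsf{D}(d)\text{ for all } d\in\{\pm\mathrm{e}_1,\dots,\pm\mathrm{e}_n\}\}$. If $P$ is a singleton, return $P$ and terminate. Otherwise set $\ell_i=-\mathsf{D}(-\mathrm{e}_i)$ and $u_i=\mathsf{D}(\mathrm{e}_i)$ for all $i$; relabelling the coordinate indices if necessary, assume $\ell_1<u_1$. Set $a=(\ell_1,\dots,\ell_n)$ and $b=(u_1,\dots,u_n)$. For $i$ from $2$ to $n$: if $\ell_i<u_i$, choose any $d\in\mathbb{R}^n$ with $d_i=1$, $d_j=0$ for all $j>i$, and $d^\top a=d^\top b$; call the oracle at $d$;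 if $\mathsf{D}(d)>d^\top a$, reset $a_i\leftarrow u_i$ and $b_i\leftarrow\ell_i$. Return $\{a,b\}$. *)

(* Defs.v *)
From HB Require Import structures.
From mathcomp Require Import all_boot all_order all_algebra perm.
From mathcomp Require Import all_classical all_reals all_analysis.

Set Implicit Arguments.
Unset Strict Implicit.
Unset Printing Implicit Defensive.

Import Order.TTheory GRing.Theory Num.Theory.
Import numFieldNormedType.Exports.

Local Open Scope classical_set_scope.
Local Open Scope ring_scope.

Section Polytopes.
Variables (R : realType) (n : nat).
Implicit Types (X : set 'rV[R]_n) (v d : 'rV[R]_n).

Definition dot v d : R := (v *m d^T) 0 0.

Definition unit_vector (i : 'I_n) : 'rV[R]_n := delta_mx 0 i.

Definition polyhedron X : Prop :=
  exists (m : nat) (A : 'I_m -> 'rV[R]_n) (c : 'I_m -> R),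
    X = [set v | forall k, dot v (A k) <= c k].

Definition polytope X : Prop := [/\ polyhedron X, X !=set0 & compact X].

Definition vertices X : set 'rV[R]_n :=
  [set v | X v /\
    forall x y (t : R), X x -> X y -> 0 < t < 1 ->
      v = (1 - t) *: x + t *: y -> x = v /\ y = v].

(* [D d] is the maximum, not only the supremum, of [v^T d] over [v] in [X]. *)
Definition max_oracle X (D : 'rV[R]_n -> R) : Prop :=
  forall d, (exists2 v, X v & D d = dot v d) /\
            (forall v, X v -> dot v d <= D d).

End Polytopes.

(* Algorithms with oracle access, as decision trees: the only information on
   the oracle D comes from the values [D d] fed to the continuations of [Query].
   [Choose C k] is the instruction "choose any x with C x, then run k x". *)
Inductive prog (R : realType) (n : nat) (A : Type) : Type :=
| Return of A
| Query of 'rV[R]_n & (R -> prog R n A)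
| Choose (T : Type) (C : T -> Prop) of (T -> prog R n A).

Arguments Return {R n A} _.
Arguments Query {R n A} _ _.
Arguments Choose {R n A T} _ _.

(* Total correctness: however the choices are made, the execution of [p] with
   oracle [D] never meets an unsatisfiable choice, and it terminates with a
   number [calls] of oracle calls and an output [o] such that [Q calls o]. *)
Fixpoint terminates_with (R : realType) (n : nat) (A : Type)
    (D : 'rV[R]_n -> R) (p : prog R n A) (Q : nat -> A -> Prop) : Prop :=
  match p with
  | Return o => Q 0%N o
  | Query d k => terminates_with D (k (D d)) (fun calls o => Q calls.+1 o)
  | Choose T C k =>
      (exists x, C x) /\ forall x, C x -> terminates_with D (k x) Q
  end.

Section TwoVertexAlgorithm.
Variables (R : realType) (n : nat).

Inductive output : Type :=
| ReturnBox of set 'rV[R]_n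
| ReturnPair of 'rV[R]_n & 'rV[R]_n.

Fixpoint query_seq A (ds : seq 'rV[R]_n) (k : seq R -> prog R n A)
    : prog R n A :=
  match ds with
  | [::] => k [::]
  | d :: ds' => Query d (fun r => query_seq ds' (fun rs => k (r :: rs)))
  end.

Definition query_family A (d : 'I_n -> 'rV[R]_n) (k : 'rV[R]_n -> prog R n A)
    : prog R n A :=
  query_seq [seq d i | i <- enum 'I_n] (fun rs => k (\row_(i < n) rs`_i)).

(* [rp] and [rm] hold the oracle values at the [e_i] and at the [- e_i]. *)
Definition box (rp rm : 'rV[R]_n) : set 'rV[R]_n :=
  [set v | forall i : 'I_n, dot v (unit_vector R i) <= rp 0 i /\
                            dot v (- unit_vector R i) <= rm 0 i].

Definition set_coord (a : 'rV[R]_n) (i : 'I_n) (x : R) : 'rV[R]_n :=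
  \row_j if j == i then x else a 0 j.

(* The permutation [s] is the relabelling of the coordinates: the coordinate
   with new label [i] is the original coordinate [s i]. *)
Definition admissible (s : 'S_n) (i : 'I_n) (a b d : 'rV[R]_n) : Prop :=
  [/\ d 0 (s i) = 1,
      forall j : 'I_n, (i < j)%N -> d 0 (s j) = 0
    & dot d a = dot d b].

Fixpoint main_loop (s : 'S_n) (l u : 'rV[R]_n) (labels : seq 'I_n)
    (a b : 'rV[R]_n) : prog R n output :=
  match labels with
  | [::] => Return (ReturnPair a b)
  | i :: labels' =>
      if l 0 (s i) < u 0 (s i) then
        Choose (admissible s i a b) (fun d =>
        Query d (fun r =>
          if dot d a < r then
            main_loop s l u labels'
              (set_coord a (s i) (u 0 (s i))) (set_coord b (s i) (l 0 (s i)))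
          else main_loop s l u labels' a b))
      else main_loop s l u labels' a b
  end.

(* Labels start at 0, so "for i from 2 to n" runs over the labels [0 < i]. *)
Definition two_vertex_algorithm : prog R n output :=
  query_family (@unit_vector R n) (fun rp =>
  query_family (fun i => - unit_vector R i) (fun rm =>
    let P := box rp rm in
    if `[< exists x, P = [set x] >] then Return (ReturnBox P)
    else
      let l := - rm in
      let u := rp in
      Choose
        (fun s : 'S_n => forall i : 'I_n, val i = 0%N -> l 0 (s i) < u 0 (s i))
        (fun s => main_loop s l u [seq i : 'I_n <- enum 'I_n | (0 < i)%N] l u))).

End TwoVertexAlgorithm.

(* Main.v *)
Require Import Defs.
From mathcomp Require Import all_boot all_order all_algebra perm.
From mathcomp Require Import all_classical all_reals all_analysis.
From mathcomp Require Import zify ring lra.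

(** A linear functional on a compact set is maximized at a vertex
    ([vertex_maximizer]), so the oracle only sees the vertices: [D d] is
    [dot p d] if there is a single vertex [p], and the maximum of [dot p d] and
    [dot q d] if the vertices are [p] and [q].  The rest of the argument
    works from these two formulas.

    With one vertex, the bounds at the unit vectors and their opposites pin down
    every coordinate, so the box is [set p] and the initial [2 * n] queries
    suffice.

    With two vertices, the corners [l] and [u] of the box are the coordinatewise
    minimum and maximum of [p] and [q], and the box, containing [p] and [q], is
    not a singleton.  It remains to find out, in each coordinate, which vertex
    carries the lower bound.  Name [p] the vertex that is lower in the first
    relabelled coordinate.  The loop turns [a] into [p] and [b] into [q] one
    coordinate at a time ([main_loop_correct]): once they agree with [p] and [q]
    before coordinate [i], a direction that vanishes after [i] and takes the
    same value at [a] and [b] makes the oracle exceed that value exactly when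
    [a] and [b] have to be exchanged at [i].  Such a direction exists because
    [a] and [b] differ in the first coordinate.  The loop adds at most one query
    for each of the [n - 1] remaining coordinates, hence [3 * n - 1] in all. *)

Set Implicit Arguments.
Unset Strict Implicit.
Unset Printing Implicit Defensive.

Import Order.TTheory GRing.Theory Num.Theory.
Import numFieldNormedType.Exports.

Local Open Scope classical_set_scope.
Local Open Scope ring_scope.

(** * The dot product *)

Lemma dotE (R : realType) (n : nat) (v d : 'rV[R]_n) :
  dot v d = \sum_j v 0 j * d 0 j.
Proof. by rewrite /dot mxE; apply: eq_bigr => j _; rewrite mxE. Qed.

Lemma dotC (R : realType) (n : nat) (v d : 'rV[R]_n) : dot v d = dot d v.
Proof. by rewrite !dotE; apply: eq_bigr => j _; rewrite mulrC. Qed.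

Lemma dotDr (R : realType) (n : nat) (v d e : 'rV[R]_n) :
  dot v (d + e) = dot v d + dot v e.
Proof. by rewrite /dot linearD mulmxDr mxE. Qed.

Lemma dotZr (R : realType) (n : nat) (c : R) (v d : 'rV[R]_n) :
  dot v (c *: d) = c * dot v d.
Proof. by rewrite /dot linearZ -scalemxAr mxE. Qed.

Lemma dotDl (R : realType) (n : nat) (v w d : 'rV[R]_n) :
  dot (v + w) d = dot v d + dot w d.
Proof. by rewrite dotC dotDr !(dotC d). Qed.

Lemma dotZl (R : realType) (n : nat) (c : R) (v d : 'rV[R]_n) :
  dot (c *: v) d = c * dot v d.
Proof. by rewrite dotC dotZr (dotC d). Qed.

Lemma dotNr (R : realType) (n : nat) (v d : 'rV[R]_n) :
  dot v (- d) = - dot v d.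
Proof. by rewrite -scaleN1r dotZr mulN1r. Qed.

Lemma dot_unit_vector (R : realType) (n : nat) (v : 'rV[R]_n) (i : 'I_n) :
  dot v (unit_vector R i) = v 0 i.
Proof.
rewrite dotE (bigD1 i) //= mxE !eqxx mulr1 big1 ?addr0 // => j /negPf ji.
by rewrite mxE ji mulr0.
Qed.

Lemma dot_eq0 (R : realType) (n : nat) (v : 'rV[R]_n) : dot v v <= 0 -> v = 0.
Proof.
rewrite dotE => v0; apply/rowP => j; rewrite mxE; apply/eqP.
have sq_ge0 i : true -> 0 <= v 0 i * v 0 i by rewrite -expr2 sqr_ge0.
have /eqP : \sum_i v 0 i * v 0 i = 0 by apply/le_anti; rewrite v0 sumr_ge0.
rewrite psumr_eq0 // => /allP/(_ j (mem_index_enum j)).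
by rewrite mulf_eq0 orbb.
Qed.

(** If [v] and [w] differ only at [k] as far as [d] can see, then [d] separates
    them by that difference alone; the loop reads one coordinate this way. *)
Lemma dot_differ_at (R : realType) (n : nat) (v w d : 'rV[R]_n) (k : 'I_n) :
  (forall j, j != k -> v 0 j = w 0 j \/ d 0 j = 0) ->
  dot v d - dot w d = (v 0 k - w 0 k) * d 0 k.
Proof.
move=> vw; rewrite !dotE -sumrB (bigD1 k) //= big1 ?addr0 -?mulrBl //.
by move=> j /vw [-> | ->]; rewrite ?subrr ?mulr0 ?subrr.
Qed.

Lemma dot_continuous (R : realType) (n : nat) (f g : 'rV[R]_n -> 'rV[R]_n) :
  (forall j, continuous (fun v => f v 0 j)) ->
  (forall j, continuous (fun v => g v 0 j)) ->
  continuous (fun v => dot (f v) (g v)).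
Proof.
move=> cf cg.
rewrite (_ : (fun v => _) = (fun v => \sum_j f v 0 j * g v 0 j)); last first.
  by apply/funext => v; rewrite dotE.
apply: continuous_big => [|j _ v]; first exact: add_continuous.
exact: (continuousM (cf j v) (cg j v)).
Qed.

(** * Linear functionals are maximized at vertices *)

(** On the face where [d] is maximal, a point of largest Euclidean norm is a
    vertex: the face property keeps both ends of a segment through it inside
    the face, and the norm is strictly convex. *)
Lemma vertex_maximizer (R : realType) (n : nat) (X : set 'rV[R]_n)
    (d : 'rV[R]_n) (M : R) :
  compact X -> (exists2 v, X v & M = dot v d) ->
  (forall v, X v -> dot v d <= M) ->
  exists2 v, vertices X v & M = dot v d.
Proof.
move=> cX [w Xw Mw] leM.
pose F := X `&` (fun v => dot v d) @^-1` [set x | x = M].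
have cF : compact F.
  apply: compact_closedI cX _.
  have /continuous_closedP cl : continuous (fun v => dot v d : R).
    apply: dot_continuous => j; first exact: coord_continuous.
    by move=> v; exact: (@cst_continuous _ _ (d 0 j)).
  by apply: cl; exact: closed_eq.
have F0 : F !=set0 by exists w; split.
have cN : continuous (fun v : 'rV[R]_n => dot v v).
  by apply: dot_continuous => j; exact: coord_continuous.
have [v /set_mem [Xv /= vM] vmax] := EVT_max_rV F0 cF (continuous_subspaceT cN).
exists v => //; split=> // x y t Xx Xy /andP[t0 t1] vE.
have dv : dot v d = (1 - t) * dot x d + t * dot y d.
  by rewrite vE dotDl !dotZl.
have [xM yM] := (leM _ Xx, leM _ Xy).
(* [M] is a proper convex combination of values at most [M]: both are [M]. *)
have dx : dot x d = M by nra.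
have dy : dot y d = M by nra.
have /vmax xv : x \in F by apply/mem_set; split.
have /vmax yv : y \in F by apply/mem_set; split.
have norm_v : dot v v = (1 - t) * dot x x + t * dot y y
                        - t * (1 - t) * dot (x - y) (x - y).
  rewrite vE -(scaleN1r y) !(dotDl, dotDr, dotZl, dotZr) (dotC y x); ring.
have xy : x = y.
  apply/eqP; rewrite -subr_eq0; apply/eqP/dot_eq0.
  have tt : 0 < t * (1 - t) by rewrite mulr_gt0 ?subr_gt0.
  rewrite -(pmulr_rle0 _ tt); nra.
(* The segment is degenerate, so [v], being on it, is its only point. *)
have xv' : x = v by rewrite vE -xy -scalerDl subrK scale1r.
by rewrite -xy.
Qed.

Lemma oracle_at_vertex (R : realType) (n : nat) (X : set 'rV[R]_n)
    (D : 'rV[R]_n -> R) :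
  compact X -> max_oracle X D ->
  forall d, exists2 v, vertices X v & D d = dot v d.
Proof. by move=> cX hD d; have [] := hD d; exact: vertex_maximizer. Qed.

Lemma oracle_one_vertex (R : realType) (n : nat) (X : set 'rV[R]_n)
    (D : 'rV[R]_n -> R) (p : 'rV[R]_n) :
  compact X -> max_oracle X D -> vertices X = [set p] ->
  forall d, D d = dot p d.
Proof.
by move=> cX hD Vp d; have [v] := oracle_at_vertex cX hD d; rewrite Vp => ->.
Qed.

Lemma oracle_two_vertices (R : realType) (n : nat) (X : set 'rV[R]_n)
    (D : 'rV[R]_n -> R) (p q : 'rV[R]_n) :
  compact X -> max_oracle X D -> vertices X = [set p; q] ->
  forall d, D d = Num.max (dot p d) (dot q d).
Proof.
move=> cX hD Vpq d.
have [Vp Vq] : vertices X p /\ vertices X q.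
  by rewrite Vpq; split; [left | right].
have [pD qD] : dot p d <= D d /\ dot q d <= D d.
  by have [_ leD] := hD d; split; apply: leD; [case: Vp | case: Vq].
apply/le_anti; rewrite ge_max pD qD andbT le_max.
have [v] := oracle_at_vertex cX hD d.
by rewrite Vpq => -[] -> ->; rewrite lexx ?orbT.
Qed.

(** * Executions of oracle programs *)

Lemma terminates_with_weaken (R : realType) (n : nat) (A : Type)
    (D : 'rV[R]_n -> R) (p : prog R n A) (P Q : nat -> A -> Prop) :
  (forall c o, P c o -> Q c o) ->
  terminates_with D p P -> terminates_with D p Q.
Proof.
elim: p P Q => [out|d k IH|T C k IH] P Q PQ /=.
- exact: PQ.
- by apply: IH => c o; exact: PQ.
- by case=> C0 kC; split=> // x Cx; apply: IH (kC x Cx).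
Qed.

Lemma terminates_query_seq (R : realType) (n : nat) (A : Type)
    (D : 'rV[R]_n -> R) (ds : seq 'rV[R]_n) (k : seq R -> prog R n A)
    (Q : nat -> A -> Prop) :
  terminates_with D (k (map D ds)) (fun c o => Q (size ds + c)%N o) ->
  terminates_with D (query_seq ds k) Q.
Proof. by elim: ds k Q => [//|d ds IH] k Q /= kQ; apply: IH. Qed.

Lemma terminates_query_family (R : realType) (n : nat) (A : Type)
    (D : 'rV[R]_n -> R) (d : 'I_n -> 'rV[R]_n) (k : 'rV[R]_n -> prog R n A)
    (Q : nat -> A -> Prop) :
  terminates_with D (k (\row_i D (d i))) (fun c o => Q (n + c)%N o) ->
  terminates_with D (query_family d k) Q.
Proof.
move=> kQ; apply: terminates_query_seq; rewrite size_map size_enum_ord.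
rewrite (_ : \row_i _ = \row_i D (d i)) //.
apply/rowP => i; rewrite !mxE -map_comp.
by rewrite (nth_map i) ?size_enum_ord // nth_ord_enum.
Qed.

(** * The main loop *)

(** Starting from the unit vector of [s i], a multiple of that of [s i0]
    compensates for the difference of [a] and [b] at [s i]. *)
Lemma admissible_exists (R : realType) (n : nat) (s : 'S_n) (i0 i : 'I_n)
    (a b : 'rV[R]_n) :
  (i0 < i)%N -> a 0 (s i0) != b 0 (s i0) -> exists d, admissible s i a b d.
Proof.
move=> i0i ab; pose c := (a 0 (s i) - b 0 (s i)) / (b 0 (s i0) - a 0 (s i0)).
exists (unit_vector R (s i) + c *: unit_vector R (s i0)); split.
- rewrite !mxE !eqxx (inj_eq perm_inj) -val_eqE gtn_eqF //=.
  by rewrite mulr0 addr0.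
- move=> j ij; rewrite !mxE !eqxx !(inj_eq perm_inj) -!val_eqE /=.
  by rewrite !gtn_eqF ?(ltn_trans i0i) //= mulr0 addr0.
- rewrite !dotDl !dotZl !(dotC (unit_vector _ _)) !dot_unit_vector /c; field.
  by rewrite subr_eq0 eq_sym.
Qed.

(** The hypotheses on [a] and [b] are the loop invariant: they are still the
    corners of the box at the pending labels, and agree with the vertices at all
    the others.  The direction [d] for label [i] vanishes after [i], so [dot d]
    sees [a - p] and [b - q] only through coordinate [s i], with coefficient 1.
    If [p] is the lower vertex there, then [dot p d], [dot q d] and the oracle
    value all equal [dot d a]; if it is the upper one, then [dot p d] exceeds
    [dot d a] and the swap is triggered. *)
Lemma main_loop_correct (R : realType) (n : nat) (D : 'rV[R]_n -> R)
    (p q l u : 'rV[R]_n) (s : 'S_n) (i0 : 'I_n) (labels : seq 'I_n)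
    (a b : 'rV[R]_n) :
  (forall d, D d = Num.max (dot p d) (dot q d)) ->
  (forall j, l 0 j = Num.min (p 0 j) (q 0 j)) ->
  (forall j, u 0 j = Num.max (p 0 j) (q 0 j)) ->
  p 0 (s i0) != q 0 (s i0) ->
  {in labels, forall i : 'I_n, (i0 < i)%N} ->
  pairwise (fun i j : 'I_n => (i < j)%N) labels ->
  {in labels, forall j, a 0 (s j) = l 0 (s j) /\ b 0 (s j) = u 0 (s j)} ->
  (forall j, j \notin labels ->
     a 0 (s j) = p 0 (s j) /\ b 0 (s j) = q 0 (s j)) ->
  terminates_with D (main_loop s l u labels a b)
    (fun c o => (c <= size labels)%N /\ o = ReturnPair p q).
Proof.
move=> DE lE uE pq0.
elim: labels a b => [|i labels IH] a b /= gt_i0 sorted_i pending treated.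
  split=> //; congr ReturnPair; apply/rowP => j; rewrite -(permKV s j);
  by have [] := treated (s^-1%g j) isT.
have [/allP i_min sorted_labels] := andP sorted_i.
have gt_i0' : {in labels, forall j : 'I_n, (i0 < j)%N}.
  by move=> j jl; apply: gt_i0; rewrite inE jl orbT.
have pending' :
    {in labels, forall j, a 0 (s j) = l 0 (s j) /\ b 0 (s j) = u 0 (s j)}.
  by move=> j jl; apply: pending; rewrite inE jl orbT.
have i_notin : i \notin labels by apply/negP => /i_min; rewrite ltnn.
have [ai bi] := pending i (mem_head _ _).
have treated' j : j \notin labels -> j != i ->
    a 0 (s j) = p 0 (s j) /\ b 0 (s j) = q 0 (s j).
  by move=> jl ji; apply: treated; rewrite inE negb_or ji.
have keep : a 0 (s i) = p 0 (s i) -> b 0 (s i) = q 0 (s i) ->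
    terminates_with D (main_loop s l u labels a b)
      (fun c o => (c <= size labels)%N /\ o = ReturnPair p q).
  move=> ap bq; apply: IH => // j jl.
  by have [-> // | /(treated' j jl)] := eqVneq j i.
case: ifPn => [lu | lu]; last first.
  (* The box is flat in this direction: [p] and [q] agree at [s i]. *)
  have [ap bq] : a 0 (s i) = p 0 (s i) /\ b 0 (s i) = q 0 (s i).
    move: lu; rewrite ai bi lE uE.
    by case: (ltgtP (p 0 (s i)) (q 0 (s i))) => [pq|pq|->]; rewrite ?pq.
  by apply: terminates_with_weaken (keep ap bq) => c o [c_le ->]; rewrite leqW.
split=> [|d [di dgt dab]].
  apply: (@admissible_exists _ _ _ i0); first exact/gt_i0/mem_head.
  have i0_notin : i0 \notin i :: labels.
    by apply/negP => /gt_i0; rewrite ltnn.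
  by have [-> ->] := treated i0 i0_notin.
have agree j : j != s i ->
    (a 0 j = p 0 j /\ b 0 j = q 0 j) \/ d 0 j = 0.
  rewrite -(permKV s j); set j' := s^-1%g j; rewrite (inj_eq perm_inj) => ji.
  have [ij | ij | /val_inj ij] := ltngtP i j'.
  - by right; apply: dgt.
  - left; apply: treated' => //; apply/negP => /i_min.
    by rewrite ltnNge ltnW.
  - by rewrite ij eqxx in ji.
have da : dot a d - dot p d = a 0 (s i) - p 0 (s i).
  rewrite (@dot_differ_at _ _ _ _ _ (s i)) ?di ?mulr1 // => j /agree.
  by move=> [[-> _] | ->]; [left | right].
have db : dot b d - dot q d = b 0 (s i) - q 0 (s i).
  rewrite (@dot_differ_at _ _ _ _ _ (s i)) ?di ?mulr1 // => j /agree.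
  by move=> [[_ ->] | ->]; [left | right].
rewrite /= (dotC d a).
move: dab; rewrite !(dotC d) => dab.
case: (ltgtP (p 0 (s i)) (q 0 (s i))) => pq.
- have [ap bq] : a 0 (s i) = p 0 (s i) /\ b 0 (s i) = q 0 (s i).
    by rewrite ai bi lE uE; move: pq; case: ltgtP.
  have -> : dot a d < D d = false.
    by rewrite DE; apply/negbTE; rewrite -leNgt ge_max; apply/andP; split; lra.
  exact: terminates_with_weaken (keep ap bq).
- have [lq up] : l 0 (s i) = q 0 (s i) /\ u 0 (s i) = p 0 (s i).
    by rewrite lE uE; move: pq; case: ltgtP.
  have -> : dot a d < D d.
    by rewrite DE lt_max; apply/orP; left; lra.
  apply: terminates_with_weaken (IH _ _ gt_i0' sorted_labels _ _) => //.
  + move=> j jl; rewrite !mxE (inj_eq perm_inj).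
    have /negPf -> : j != i by apply: contraNneq i_notin => <-.
    exact: pending'.
  + move=> j jl; rewrite !mxE (inj_eq perm_inj).
    by have [-> // | /(treated' j jl)] := eqVneq j i.
- by move: lu; rewrite lE uE pq minxx maxxx ltxx.
Qed.

(** * The two runs of the algorithm *)

Lemma two_vertex_algorithm_one (R : realType) (n : nat) (D : 'rV[R]_n -> R)
    (p : 'rV[R]_n) :
  (forall d, D d = dot p d) ->
  terminates_with D (two_vertex_algorithm R n)
    (fun c o => c = (2 * n)%N /\ o = ReturnBox [set p]).
Proof.
move=> DE; rewrite /two_vertex_algorithm.
apply: terminates_query_family; apply: terminates_query_family.
set P := box _ _.
have PE : P = [set p].
  apply/seteqP; split=> v /=.
    move=> Pv; apply/rowP => i; have := Pv i.
    rewrite !mxE !DE !dotNr !dot_unit_vector lerN2 => -[vp pv].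
    by apply/le_anti; rewrite vp pv.
  by move=> -> i; rewrite !mxE !DE.
case: asboolP => [_ | []]; last by exists p.
by rewrite /= PE addn0 mul2n addnn.
Qed.

Lemma two_vertex_algorithm_two (R : realType) (n : nat) (D : 'rV[R]_n -> R)
    (p q : 'rV[R]_n) :
  p != q -> (forall d, D d = Num.max (dot p d) (dot q d)) ->
  terminates_with D (two_vertex_algorithm R n)
    (fun c o => (c <= 3 * n - 1)%N /\
       (o = ReturnPair p q \/ o = ReturnPair q p)).
Proof.
move=> pq DE; rewrite /two_vertex_algorithm.
apply: terminates_query_family; apply: terminates_query_family.
set rp := \row_i D (unit_vector R i); set rm := \row_i D (- unit_vector R i).
have uE j : rp 0 j = Num.max (p 0 j) (q 0 j).
  by rewrite mxE DE !dot_unit_vector.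
have lE j : (- rm) 0 j = Num.min (p 0 j) (q 0 j).
  by rewrite !mxE DE !dotNr !dot_unit_vector oppr_max !opprK.
case: asboolP => [[x Px] | _] /=.
  (* Both vertices lie in the box, so it cannot be a singleton. *)
  have [px qx] : box rp rm p /\ box rp rm q.
    by split=> i; rewrite !mxE !DE !le_max !lexx ?orbT.
  by move: px qx pq; rewrite Px => -> ->; rewrite eqxx.
have lu j : ((- rm) 0 j < rp 0 j) = (p 0 j != q 0 j).
  by rewrite lE uE; case: (ltgtP (p 0 j) (q 0 j)) => //= ->; rewrite ltxx.
split.
  have /existsP[j pqj] : [exists j, p 0 j != q 0 j].
    rewrite -negb_forall; apply: contra pq => /forallP pq.
    by apply/eqP/rowP => j; apply/eqP; have := pq j.
  have n0 : (0 < n)%N by case: (n) j {pqj} => [[]|].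
  exists (tperm (Ordinal n0) j) => i i0.
  by rewrite (_ : i = Ordinal n0) ?tpermL ?lu //; apply: val_inj.
move=> s sP.
have n0 : (0 < n)%N.
  case: (posnP n) => // n0; case/negP: pq; apply/eqP/rowP => j.
  by have := ltn_ord j; rewrite {2}n0.
pose i0 := Ordinal n0.
set labels := [seq i : 'I_n <- enum 'I_n | (0 < i)%N].
have labels_gt : {in labels, forall i : 'I_n, (i0 < i)%N}.
  by move=> i; rewrite mem_filter => /andP[].
have sorted_labels : pairwise (fun i j : 'I_n => (i < j)%N) labels.
  rewrite pairwise_filter // -(pairwise_map val ltn) val_enum_ord.
  by rewrite -sorted_pairwise ?iota_ltn_sorted //; exact: ltn_trans.
have notin_labels j : j \notin labels -> j = i0.
  by rewrite mem_filter mem_enum andbT -eqn0Ngt => /eqP j0; apply: val_inj.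
have size_labels : (n + (n + size labels) <= 3 * n - 1)%N.
  suff : (size labels < n)%N by lia.
  rewrite -[X in (_ < X)%N](size_enum_ord n) size_filter.
  rewrite -(count_predC (fun i : 'I_n => (0 < i)%N)) -addn1.
  rewrite leq_add2l -has_count.
  by apply/hasP; exists i0; rewrite ?mem_enum.
have bound c : (c <= size labels)%N -> (n + (n + c) <= 3 * n - 1)%N.
  by move=> cl; apply: leq_trans size_labels; rewrite !leq_add2l.
have pq0 : p 0 (s i0) != q 0 (s i0) by rewrite -lu sP.
(* Neither [p] nor [q] is distinguished: the output starts with the one that
   is lower at [s i0], where the initial [a] has the lower bound. *)
case: (ltgtP (p 0 (s i0)) (q 0 (s i0))) => [lt0 | lt0 | eq0].
- apply: (terminates_with_weaken _ (@main_loop_correct _ _ _ p q _ _ _ i0 _ _ _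
    _ lE uE pq0 labels_gt sorted_labels _ _)) => //.
  + by move=> c o [/bound cl ->]; split=> //; left.
  + move=> j /notin_labels ->; rewrite lE uE.
    by move: lt0; case: ltgtP.
- apply: (terminates_with_weaken _ (@main_loop_correct _ _ _ q p _ _ _ i0 _ _ _
    _ _ _ _ labels_gt sorted_labels _ _)) => //.
  + by move=> c o [/bound cl ->]; split=> //; right.
  + by move=> d; rewrite DE maxC.
  + by move=> j; rewrite lE minC.
  + by move=> j; rewrite uE maxC.
  + by rewrite eq_sym.
  + move=> j /notin_labels ->; rewrite lE uE.
    by move: lt0; case: ltgtP.
- by rewrite eq0 eqxx in pq0.
Qed.

(** * Conclusion *)

Lemma card_eq1P (T : choiceType) (A : set T) :
  (A #= `I_1)%card -> exists x, A = [set x].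
Proof.
move=> /eq_cardSP[x Ax]; rewrite II0 card_eq0 => /eqP A0.
by exists x; rewrite -(setD1K Ax) A0 setU0.
Qed.

Lemma card_eq2P (T : choiceType) (A : set T) :
  (A #= `I_2)%card -> exists x y, x != y /\ A = [set x; y].
Proof.
move=> /eq_cardSP[x Ax] /card_eq1P[y Ay]; exists x, y; split.
  by have : [set y] y by []; rewrite -Ay => -[_ /eqP]; rewrite eq_sym.
by rewrite -(setD1K Ax) Ay.
Qed.

Theorem theorem4p2 (R : realType) (n : nat) (X : set 'rV[R]_n)
    (D : 'rV[R]_n -> R) (nv : nat)
    (hX : polytope X)
    (hD : max_oracle X D)
    (hnv : (vertices X #= `I_nv)%card)
    (hnv12 : nv = 1%N \/ nv = 2%N) :
  (nv = 1%N ->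
     terminates_with D (two_vertex_algorithm R n)
       (fun calls o => calls = (2 * n)%N /\
          exists x : 'rV[R]_n,
            o = ReturnBox [set x] /\ vertices X = [set x])) /\
  (nv = 2%N ->
     terminates_with D (two_vertex_algorithm R n)
       (fun calls o => (calls <= 3 * n - 1)%N /\
          exists a b : 'rV[R]_n,
            o = ReturnPair a b /\ vertices X = [set a; b])).
Proof.
have [_ _ cX] := hX; split=> nvE; move: hnv; rewrite nvE.
- move=> /card_eq1P[p Vp].
  apply: terminates_with_weaken
    (two_vertex_algorithm_one (oracle_one_vertex cX hD Vp)) => c o [-> ->].
  by split=> //; exists p.
- move=> /card_eq2P[p [q [pq Vpq]]].
  apply: terminates_with_weaken
    (two_vertex_algorithm_two pq (oracle_two_vertices cX hD Vpq)) => c o.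
  move=> [cl [->|->]]; split=> //; first by exists p, q.
  by exists q, p; rewrite Vpq setUC.
Qed.
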